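(* There exists a sequence of weighted metrics $(T^2,g_i,f_i)$, $i\in\mathbb N$, on the $2$-torus $T^2$ (with $g_i$ a smooth Riemannian metric and $f_i\colon T^2\to\mathbb R$ a smooth function) such that for any $N>2$ it holds that $\sec_{g_i}\le 1/i$, $\operatorname{Ric}_{f_i,N}\ge-\varepsilon_i(N)$ and $\operatorname{diam}(T^2,g_i)\le 10$, where $\varepsilon_i(N)\to 0$ as $i\to\infty$, and such that $\min\sec_{g_i}\to-\infty$ as $i\to\infty$.
   Context: For a Riemannian metric $g$ on an $n$-manifold, a smooth function $f$, and $N>n$, the Bakry–Emery Ricci tensor of the weighted manifold $(M^n,g,e^{-f}\mathcal H_n)$ is $\operatorname{Ric}_{f,N}=\operatorname{Ric}+\operatorname{Hess} f-\frac{df\otimes df}{N-n}$ (here $n=2$; all terms computed with respect to $g$). $\operatorname{Ric}_{f,N}\ge\kappa$ means $\operatorname{Ric}_{f,N}(v,v)\ge\kappa|v|_g^2$ for all tangent vectors $v$. *)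

(* Defs.v *)
(* Riemannian geometry on the n-torus T^n = R^n / Z^n, in the global coordinates
   of its universal cover: points and tangent vectors are row vectors
   'rV[R]_n, and functions and tensor fields on T^n are Z^n-periodic ones on
   R^n. *)
From HB Require Import structures.
From mathcomp Require Import all_boot all_order all_algebra.
From mathcomp Require Import all_classical all_reals all_analysis.

Set Implicit Arguments.
Unset Strict Implicit.
Unset Printing Implicit Defensive.
Import Order.TTheory GRing.Theory Num.Theory.
Import numFieldNormedType.Exports.

Local Open Scope classical_set_scope.
Local Open Scope ring_scope.

Section Smooth.
Context {R : realType} {n : nat}.
Implicit Type f : 'rV[R]_n -> R.

Definition partial (i : 'I_n) f : 'rV[R]_n -> R := 'D_(delta_mx 0 i) f.

Fixpoint Ck (k : nat) f : Prop :=
  continuous f /\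
  match k with
  | 0 => True
  | k'.+1 => forall i : 'I_n,
      (forall x, derivable f x (delta_mx 0 i)) /\ Ck k' (partial i f)
  end.

Definition smooth f : Prop := forall k, Ck k f.

Definition periodic {T : Type} (F : 'rV[R]_n -> T) : Prop :=
  forall (x : 'rV[R]_n) (z : 'rV[int]_n), F (x + map_mx intr z) = F x.

Definition bilin (A : 'M[R]_n) (v w : 'rV[R]_n) : R := (v *m A *m w^T) 0 0.

End Smooth.

Record torus_fun (R : realType) (n : nat) := TorusFun {
  tfun :> 'rV[R]_n -> R;
  tfun_periodic : periodic tfun;
  tfun_smooth : smooth tfun }.

(* [gram g x i j] is g(d_i, d_j) at x. *)
Record torus_metric (R : realType) (n : nat) := TorusMetric {
  gram :> 'rV[R]_n -> 'M[R]_n;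
  gram_periodic : periodic gram;
  gram_smooth : forall i j, smooth (fun x => gram x i j);
  gram_sym : forall x, (gram x)^T = gram x;
  gram_posdef : forall x v, v != 0 -> 0 < bilin (gram x) v v }.

Section Curvature.
Context {R : realType} {n : nat} (g : torus_metric R n).
Implicit Types (f : torus_fun R n) (x u v w : 'rV[R]_n) (i j k l m : 'I_n).

(* Gamma^k_ij *)
Definition christoffel k i j x : R :=
  2^-1 * \sum_l invmx (g x) k l *
    (partial i (fun y => g y j l) x + partial j (fun y => g y i l) x
     - partial l (fun y => g y i j) x).

(* R(d_k, d_l) d_j = \sum_i (riemann i j k l) d_i, where
   R(X, Y) Z = nabla_X nabla_Y Z - nabla_Y nabla_X Z - nabla_[X, Y] Z. *)
Definition riemann i j k l x : R :=
  partial k (christoffel i l j) x - partial l (christoffel i k j) x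
  + \sum_m (christoffel i k m x * christoffel m l j x
            - christoffel i l m x * christoffel m k j x).

(* R(u, v) w *)
Definition curvature_op x u v w : 'rV[R]_n :=
  \row_i \sum_j \sum_k \sum_l riemann i j k l x * u 0 k * v 0 l * w 0 j.

(* Sectional curvature of the plane spanned by v and w; only meaningful when
   they are linearly independent. *)
Definition sec x v w : R :=
  bilin (g x) (curvature_op x v w w) v /
  (bilin (g x) v v * bilin (g x) w w - bilin (g x) v w ^+ 2).

Definition sec_le (c : R) : Prop :=
  forall x v w, row_free (col_mx v w) -> sec x v w <= c.

(* The minimum of sec over all tangent planes: the infimum is attained, as the
   Grassmann bundle of 2-planes of T^n is compact (and nonempty if n >= 2). *)
Definition min_sec : \bar R :=
  ereal_inf [set s | exists x v w,
    row_free (col_mx v w) /\ s = (sec x v w)%:E].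

(* Ric(v, w) = trace of u |-> R(u, v) w *)
Definition ricci x : 'M[R]_n := \matrix_(l, j) \sum_k riemann k j k l x.

Definition hess f x : 'M[R]_n :=
  \matrix_(i, j) (partial i (partial j f) x
                  - \sum_k christoffel k i j x * partial k f x).

Definition df_otimes_df f x : 'M[R]_n :=
  \matrix_(i, j) (partial i f x * partial j f x).

Definition bakry_emery f (N : R) x : 'M[R]_n :=
  ricci x + hess f x - (N - n%:R)^-1 *: df_otimes_df f x.

Definition bakry_emery_ge f (N kappa : R) : Prop :=
  forall x v, kappa * bilin (g x) v v <= bilin (bakry_emery f N x) v v.

End Curvature.

Section Diameter.
Context {R : realType} {n : nat} (g : torus_metric R n).
Implicit Types (p q : 'rV[R]_n) (gamma : R -> 'rV[R]_n).

Definition C1_curve gamma : Prop :=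
  (forall t, derivable gamma t 1) /\ continuous (derive1 gamma).

Definition arc_length gamma (a b : R) : \bar R :=
  (\int[lebesgue_measure]_(t in `[a, b])
     (Num.sqrt (bilin (g (gamma t)) (derive1 gamma t) (derive1 gamma t)))%:E)%E.

(* [path_length p q L]: some piecewise C^1 path in R^n from p to q has
   length L. *)
Inductive path_length : 'rV[R]_n -> 'rV[R]_n -> \bar R -> Prop :=
| path_arc gamma a b : a <= b -> C1_curve gamma ->
    path_length (gamma a) (gamma b) (arc_length gamma a b)
| path_cat p q r L M : path_length p q L -> path_length q r M ->
    path_length p r (L + M)%E.

(* Paths in T^n between the classes of p and q are the projections of paths in
   R^n from p to some Z^n-translate of q. *)
Definition dist p q : \bar R :=
  ereal_inf [set L | exists z : 'rV[int]_n, path_length p (q + map_mx intr z) L].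

Definition diam : \bar R := ereal_sup [set d | exists p q, d = dist p q].

End Diameter.

(* Main.v *)
Require Import Defs.
From mathcomp Require Import all_boot all_order all_algebra.
From mathcomp Require Import all_classical all_reals all_analysis.
From mathcomp Require Import measurable_realfun ring lra.
Import Order.TTheory GRing.Theory Num.Theory.
Import numFieldNormedType.Exports.
Local Open Scope classical_set_scope.
Local Open Scope ring_scope.

(** The metrics are conformal to the flat torus, [g = e^(2u) g_0], and the
    weight is twice the conformal exponent: [u = c F] and [f = 2 c F] for a
    function [F] on the torus and a small constant [c].  On a surface
    [sec = - e^(-2u) Lap u] and [Ric = sec * g], so that in coordinates the
    Ricci tensor is [- (Lap u) I].  Suppose that

      [Hess F = Lam I + E]  with [|F|], [|dF|], [|E|] bounded by [C].

    Then [- (Lap u) I = - 2 c Lam I + O(c C)] and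
    [Hess f = 2 c Lam I + O(c C)]: the large function [Lam] drops out of
    [Ric + Hess f] ([bakry_emery_lower_bound]).  The Christoffel symbols and the
    term [df (x) df / (N - 2)] are quadratic in [c dF], hence [O((c C)^2)].  So
    [Ric_(f,N) >= - O(c C)] no matter how large [Lam] is.  If moreover
    [Lam >= - C], then [sec <= O(c C)], and at a point where [c Lam] is large
    the curvature is very negative, about [- 2 c Lam].

    It remains to find such an [F] with [C] fixed and [Lam] unbounded.  In the
    plane the model is [- r^2 ln (r^2)]: it is C^1, and its Hessian is
    [- 2 ln (r^2) I] up to a bounded term.  Its smooth periodic version is
    [F = - s ln s] with [s = eta + sum_i (1 - cos (2 pi x_i))], for which
    [Lam = - 4 pi^2 ln s]; the bound [C] does not depend on [eta] because
    [s (ln s)^2] and [|ds|^2 / s] are bounded ([partial_log_potential_bound],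
    [hess_log_potential_bound]).  At the origin [Lam = - 4 pi^2 ln eta].  Taking
    [c] of order [1 / (i + 1)] and [eta = exp (- (i + 1)^2)] makes [c C] tend to
    [0] while [c Lam] at the origin grows like [i + 1]. *)

(** * Directional derivatives and smooth functions *)

Section DirectionalDerivative.
Context {R : realType} {V : normedModType R}.
Implicit Types (f : V -> R) (x v : V).

(** A directional derivative is the derivative of a function of one real
    variable; this brings in the one-dimensional chain rule. *)
Lemma is_derive_lineP f x v (df : R) :
  is_derive x v f df <->
  is_derive (0 : R) (1 : R) (fun h : R => f (h *: v + x)) df.
Proof.
have lineE : 'D_1 (fun h : R => f (h *: v + x)) 0 = 'D_v f x.
  rewrite /derive; set F := (X in lim (X @ _)); set G := (X in _ = lim (X @ _)).
  suff -> : F = G by []; rewrite /F /G.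
  by apply/funext => h /=; rewrite addr0 scale0r add0r [_%:A]mulr1.
split=> -[fxv <-].
  exact: DeriveDef ((derivable1P f x v).1 fxv) lineE.
exact: DeriveDef ((derivable1P f x v).2 fxv) (esym lineE).
Qed.

Lemma is_derive_comp1 {phi : R -> R} {f x v} {dphi df : R} :
  is_derive (f x) 1 phi dphi -> is_derive x v f df ->
  is_derive x v (phi \o f) (dphi * df).
Proof.
move=> Hphi /is_derive_lineP Hf; apply/is_derive_lineP.
apply: (@is_derive1_comp _ phi (fun h : R => f (h *: v + x))) => //.
by rewrite scale0r add0r.
Qed.

End DirectionalDerivative.

Section SmoothFunctions.
Context {R : realType} {n : nat}.
Implicit Types (f g : 'rV[R]_n -> R) (i j : 'I_n).

Lemma is_derive_coord i (x v : 'rV[R]_n) :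
  is_derive x v (fun y : 'rV[R]_n => y 0 i) (v 0 i).
Proof.
apply/is_derive_lineP.
rewrite (_ : (fun h : R => _) = (fun h : R => h * v 0 i + x 0 i)); last first.
  by apply/funext => h; rewrite !mxE.
by apply: is_derive_eq; rewrite /GRing.scale /=; ring.
Qed.

Lemma Ck_continuous {k f} : Ck k f -> continuous f.
Proof. by case: k => [|k] []. Qed.

Lemma CkS k f : Ck k.+1 f -> Ck k f.
Proof.
elim: k f => [|k IHk] f [cf df]; split=> // i.
by have [fi /IHk] := df i.
Qed.

Lemma Ck_cst k (a : R) : Ck k (fun _ : 'rV[R]_n => a).
Proof.
elim: k a => [|k IHk] a; split=> //; try exact: cst_continuous.
move=> i; split=> [x|]; first exact: derivable_cst.
rewrite (_ : partial i _ = fun=> 0) //.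
by apply/funext => x; exact: derive_cst.
Qed.

Lemma partialD i f g :
  (forall x, derivable f x (delta_mx 0 i)) ->
  (forall x, derivable g x (delta_mx 0 i)) ->
  partial i (f \+ g) = partial i f \+ partial i g.
Proof. by move=> df dg; apply/funext => x; exact: deriveD. Qed.

Lemma partialM i f g :
  (forall x, derivable f x (delta_mx 0 i)) ->
  (forall x, derivable g x (delta_mx 0 i)) ->
  partial i (f \* g) = (f \* partial i g) \+ (g \* partial i f).
Proof. by move=> df dg; apply/funext => x; exact: deriveM. Qed.

Lemma CkD k f g : Ck k f -> Ck k g -> Ck k (f \+ g).
Proof.
elim: k f g => [|k IHk] f g [cf df] [cg dg]; split=> //;
  try by move=> x; apply: continuousD; [exact: cf|exact: cg].
move=> i; have [{}df Cf] := df i; have [{}dg Cg] := dg i.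
by split=> [x|]; [exact: derivableD|rewrite partialD//; exact: IHk].
Qed.

Lemma CkM k f g : Ck k f -> Ck k g -> Ck k (f \* g).
Proof.
elim: k f g => [|k IHk] f g Cf Cg;
  have [cf df] := Cf; have [cg dg] := Cg; split=> //;
  try by move=> x; apply: continuousM; [exact: cf|exact: cg].
move=> i; have [{}df C'f] := df i; have [{}dg C'g] := dg i.
split=> [x|]; first exact: derivableM.
by rewrite partialM//; apply: CkD; apply: IHk => //; exact: CkS.
Qed.

Lemma smooth_cst (a : R) : smooth (fun _ : 'rV[R]_n => a).
Proof. by move=> k; exact: Ck_cst. Qed.

Lemma smoothD {f g} : smooth f -> smooth g -> smooth (f \+ g).
Proof. by move=> Cf Cg k; exact: CkD. Qed.

Lemma smoothM {f g} : smooth f -> smooth g -> smooth (f \* g).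
Proof. by move=> Cf Cg k; exact: CkM. Qed.

Lemma smoothZ (a : R) {f} : smooth f -> smooth (fun x => a * f x).
Proof. exact: (smoothM (smooth_cst a)). Qed.

Lemma smooth_sum (I : Type) (r : seq I) (F : I -> 'rV[R]_n -> R) :
  (forall a, smooth (F a)) -> smooth (fun x => \sum_(a <- r) F a x).
Proof.
move=> CF; elim: r => [|a r IHr].
  rewrite (_ : (fun x => _) = fun=> 0); first exact: smooth_cst.
  by apply/funext => x; rewrite big_nil.
rewrite (_ : (fun x => _) = F a \+ (fun x => \sum_(b <- r) F b x)).
  exact: smoothD.
by apply/funext => x; rewrite big_cons.
Qed.

Lemma smooth_derivable {f} i x : smooth f -> derivable f x (delta_mx 0 i).
Proof. by move=> /(_ 1)[_ /(_ i)[]]. Qed.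

Lemma smooth_is_derive {f} i x :
  smooth f -> is_derive x (delta_mx 0 i) f (partial i f x).
Proof. by move=> /(smooth_derivable i x) /derivableP. Qed.

Lemma smooth_partial {f} i : smooth f -> smooth (partial i f).
Proof. by move=> Cf k; have [_ /(_ i)[]] := Cf k.+1. Qed.

Lemma smooth_coord i : smooth (fun x : 'rV[R]_n => x 0 i).
Proof.
case=> [|k]; split=> //; try exact: coord_continuous.
move=> j; split=> [x|]; first by have [] := is_derive_coord i x (delta_mx 0 j).
rewrite (_ : partial j _ = fun=> (delta_mx 0 j : 'rV[R]_n) 0 i).
  exact: Ck_cst.
by apply/funext => x; have [] := is_derive_coord i x (delta_mx 0 j).
Qed.

(** Naming all the successive derivatives of [phi 0] at once makes the chain
    rule for [Ck] a single induction. *)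
Definition derivative_tower (D : set R) (phi : nat -> R -> R) : Prop :=
  forall m y, D y -> is_derive y 1 (phi m) (phi m.+1 y).

(** The induction on the order [k] is for all [phi m] at once, because a partial
    derivative of [phi m \o f] involves [phi m.+1 \o f]. *)
Lemma smooth_comp {D : set R} {phi f} :
  derivative_tower D phi -> (forall x, D (f x)) -> smooth f ->
  smooth (phi 0%N \o f).
Proof.
move=> Dphi Df Cf k; suff: forall m, Ck k (phi m \o f) by apply.
have cphi m : continuous (phi m \o f).
  move=> x; apply: continuous_comp; first exact: (Ck_continuous (Cf 0%N)).
  have [dphi _] := Dphi m _ (Df x).
  exact/differentiable_continuous/derivable1_diffP.
elim: k => [|k IHk] m; split=> // i.
have dphif x : is_derive x (delta_mx 0 i) (phi m \o f)
    (phi m.+1 (f x) * partial i f x).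
  by apply: is_derive_comp1; [exact: Dphi|exact: smooth_is_derive].
split=> [x|]; first by have [] := dphif x.
rewrite (_ : partial i _ = (phi m.+1 \o f) \* partial i f).
  exact/CkM/smooth_partial.
by apply/funext => x; have [] := dphif x.
Qed.

Lemma smooth_expR {f} : smooth f -> smooth (expR \o f).
Proof.
apply: (@smooth_comp setT (fun=> expR)) => // m y _; exact: is_derive_expR.
Qed.

Lemma smooth_cos {f} : smooth f -> smooth (cos \o f).
Proof.
rewrite (_ : cos = fun y => cos (y + (pi / 2) *+ 0)); last first.
  by apply/funext => y; rewrite mulr0n addr0.
apply: (@smooth_comp setT (fun m y => cos (y + (pi / 2) *+ m))) => // m y _.
apply: (@is_derive_eq _ _ _ _ _ _ _
  (- sin (y + (pi / 2) *+ m) * 1)); last first.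
  by rewrite mulr1 (mulrSr _ m) addrA cosDpihalf.
apply: (@is_derive1_comp _ cos (fun y => y + (pi / 2) *+ m)).
by apply: is_derive_eq; rewrite addr0.
Qed.

Lemma smooth_ln {f} : (forall x, 0 < f x) -> smooth f -> smooth (@ln R \o f).
Proof.
pose phi m (y : R) :=
  if m is p.+1 then (-1) ^+ p * p`!%:R * y^-1 ^+ p.+1 else ln y.
apply: (@smooth_comp [set y | 0 < y] phi) => -[|m] y /= y0.
  by rewrite fact0 expr0 expr1 !mul1r; exact: is_derive1_ln.
have y1 : is_derive y (1 : R) (fun z : R => z^-1) (- y ^- 2).
  have := @is_deriveV _ id y 1 1; rewrite [_ *: 1]mulr1 => H.
  by apply: H; rewrite gt_eqF.
rewrite (_ : phi m.+1 =
    ((-1) ^+ m * m`!%:R) *: (fun z : R => z^-1) ^+ m.+1); last first.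
  by apply/funext => z; rewrite /= /GRing.scale /= exprfctE.
apply: (is_derive_eq (is_deriveZ _ (is_deriveX m.+1 y1))).
rewrite factS natrM -exprVn !exprS /GRing.scale /=; ring.
Qed.

End SmoothFunctions.

(** * Metrics conformal to the flat metric *)

Section Conformal.
Context {R : realType} {n : nat}.
Implicit Types (a b : R) (x v w : 'rV[R]_n) (i j k l : 'I_n).

Lemma bilin_sum (A : 'M[R]_n) v w :
  bilin A v w = \sum_i \sum_j v 0 i * A i j * w 0 j.
Proof.
rewrite /bilin mxE exchange_big; apply: eq_bigr => j _ /=.
by rewrite !mxE mulr_suml.
Qed.

Lemma bilin_scalar a v w : bilin a%:M v w = a * \sum_i v 0 i * w 0 i.
Proof.
rewrite /bilin mul_mx_scalar -scalemxAl !mxE; congr (_ * _).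
by apply: eq_bigr => i _; rewrite !mxE.
Qed.

Lemma sum_sqr_gt0 v : v != 0 -> 0 < \sum_i v 0 i * v 0 i.
Proof.
move=> v0; rewrite lt0r sumr_ge0 ?andbT; last first.
  by move=> i _; rewrite -expr2 sqr_ge0.
apply: contra v0 => /eqP /psumr_eq0P H; apply/eqP/rowP => i; rewrite mxE.
by apply/eqP; rewrite -sqrf_eq0 expr2 H // => j _; rewrite -expr2 sqr_ge0.
Qed.

Section ConformalMetric.
Variable u : torus_fun R n.

Let rho x : R := expR (2 * u x).

Let rho_smooth : smooth rho.
Proof. exact/smooth_expR/smoothZ/tfun_smooth. Qed.

Lemma conformal_periodic : Defs.periodic (fun x => (rho x)%:M : 'M[R]_n).
Proof. by move=> x z; rewrite /rho tfun_periodic. Qed.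

Lemma conformal_smooth i j : smooth (fun x => (rho x)%:M i j : R).
Proof.
rewrite (_ : (fun x => _) = fun x => (i == j)%:R * rho x); first exact: smoothZ.
by apply/funext => x; rewrite mxE mulr_natl.
Qed.

Lemma conformal_posdef x v : v != 0 -> 0 < bilin (rho x)%:M v v.
Proof. by move=> v0; rewrite bilin_scalar mulr_gt0 ?expR_gt0 ?sum_sqr_gt0. Qed.

Definition conformal_metric : torus_metric R n :=
  TorusMetric conformal_periodic conformal_smooth
    (fun x => tr_scalar_mx n (rho x)) conformal_posdef.

Lemma gram_conformal x : conformal_metric x = (expR (2 * u x))%:M.
Proof. by []. Qed.

Lemma partial_gram_conformal i j l x :
  partial l (fun y => conformal_metric y i j) x =
  (i == j)%:R * (rho x * (2 * partial l u x)).
Proof.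
rewrite /partial (_ : (fun y => _) = fun y => (i == j)%:R * rho y); last first.
  by apply/funext => y; rewrite [LHS]mxE [RHS]mulr_natl.
have Du := smooth_is_derive l x (tfun_smooth u).
have D2u : is_derive x (delta_mx 0 l) (fun y => 2 * u y) (2 * partial l u x).
  exact: is_deriveZ.
have : is_derive x (delta_mx 0 l) rho (rho x * (2 * partial l u x)).
  by apply: is_derive_comp1 D2u; exact: is_derive_expR.
by move=> /(is_deriveZ (i == j)%:R)[_]; exact.
Qed.

(** The classical formula: conformal rescaling by [e^(2u)] changes the flat
    connection by terms linear in [du]. *)
Lemma christoffel_conformal k i j x :
  christoffel conformal_metric k i j x =
  (k == j)%:R * partial i u x + (k == i)%:R * partial j u x
  - (i == j)%:R * partial k u x.
Proof.
rewrite /christoffel gram_conformal invmx_scalar (bigD1 k) //= big1 => [|l lk].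
  rewrite !partial_gram_conformal mxE eqxx mulr1n addr0 /rho.
  rewrite (eq_sym j k) (eq_sym i k).
  have r0 : expR (2 * u x) != 0 by rewrite gt_eqF ?expR_gt0.
  by move: (partial i u x) (partial j u x) (partial k u x) (expR _) r0
    => ai aj ak r r0; field.
by rewrite mxE eq_sym (negPf lk) mulr0n mul0r.
Qed.

Lemma hess_conformal (f : torus_fun R n) x i j :
  hess conformal_metric f x i j =
  partial i (partial j f) x
  - (partial i u x * partial j f x + partial j u x * partial i f x
     - (i == j)%:R * \sum_k partial k u x * partial k f x).
Proof.
rewrite mxE; congr (_ - _).
under eq_bigr do rewrite christoffel_conformal !mulrDl.
rewrite !big_split /= (bigD1 j) //= [X in _ + X + _](bigD1 i) //= !eqxx !mul1r.
rewrite big1 => [|k /negPf->]; last by rewrite !mul0r.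
rewrite big1 => [|k /negPf->]; last by rewrite !mul0r.
rewrite !addr0 mulr_sumr -sumrN; congr (_ + _ + _).
by apply: eq_bigr => k _; rewrite mulNr mulrA.
Qed.

End ConformalMetric.
End Conformal.

(** * Curvature of conformal metrics on the 2-torus *)

Section ConformalSurface.
Context {R : realType}.
Implicit Types (x v w : 'rV[R]_2) (i j k l : 'I_2).

Lemma sum_ord2 (V : nmodType) (F : 'I_2 -> V) : \sum_i F i = F 0 + F 1.
Proof.
rewrite !big_ord_recl big_ord0 addr0.
by congr (F _ + F _); apply: val_inj.
Qed.

Lemma ord2P i : i = 0 \/ i = 1.
Proof. by case: i => -[|[|//]] ?; [left|right]; apply: val_inj. Qed.

Lemma det_mx22 (A : 'M[R]_2) : \det A = A 0 0 * A 1 1 - A 0 1 * A 1 0.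
Proof.
rewrite (expand_det_row _ 0) sum_ord2 /cofactor !det_mx11.
have l0 : lift 0 0 = 1 :> 'I_2 by apply: val_inj.
have l1 : lift 1 0 = 0 :> 'I_2 by apply: val_inj.
by rewrite !mxE l0 l1 expr0 expr1 mul1r mulN1r mulrN.
Qed.

Lemma row_free_plane v w :
  row_free (col_mx v w) = (v 0 0 * w 0 1 - v 0 1 * w 0 0 != 0).
Proof.
rewrite (row_free_unit (col_mx v w : 'M[R]_2)) unitmxE unitfE det_mx22.
have rowv i : (col_mx v w : 'M[R]_2) 0 i = v 0 i.
  rewrite -(col_mxEu v w 0 i); congr (col_mx v w _ i); exact: val_inj.
have roww i : (col_mx v w : 'M[R]_2) 1 i = w 0 i.
  rewrite -(col_mxEd v w 0 i); congr (col_mx v w _ i); exact: val_inj.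
by rewrite !rowv !roww.
Qed.

(** The curvature identity below, with [a] for the first and [H] for the second
    derivatives of [u].  The quadratic terms in [a] cancel, and what is left of
    the second derivatives is their trace. *)
Lemma riemann_algebra (a : 'I_2 -> R) (H : 'I_2 -> 'I_2 -> R) i j k l :
  let G p q r := (p == r)%:R * a q + (p == q)%:R * a r - (q == r)%:R * a p in
  H 1 0 = H 0 1 ->
  ((i == j)%:R * H k l + (i == l)%:R * H k j - (l == j)%:R * H k i)
  - ((i == j)%:R * H l k + (i == k)%:R * H l j - (k == j)%:R * H l i)
  + \sum_m (G i k m * G m l j - G i l m * G m k j) =
  - (\sum_m H m m)
    * ((i == k)%:R * (j == l)%:R - (i == l)%:R * (j == k)%:R).
Proof.
move=> G; rewrite {}/G !sum_ord2.
case: (ord2P i) => ->; case: (ord2P j) => ->; case: (ord2P k) => ->;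
  case: (ord2P l) => -> S; rewrite ?S /=; ring.
Qed.

(** Expansion of the tensor on [(v, v)], with [a], [b], [H] for [du], [df] and
    the flat Hessian of [f], [L] for the Laplacian of [u] and [c] for
    [1 / (N - 2)]. *)
Lemma bakry_emery_algebra (a b : 'I_2 -> R) (H : 'I_2 -> 'I_2 -> R)
    (v : 'I_2 -> R) (L c : R) :
  \sum_i \sum_j v i *
    (- L * (i == j)%:R
     + (H i j - (a i * b j + a j * b i - (i == j)%:R * \sum_k a k * b k))
     - c * (b i * b j)) * v j =
  \sum_i \sum_j v i * H i j * v j
  + (\sum_i a i * b i - L) * (\sum_i v i ^+ 2)
  - 2 * (\sum_i a i * v i) * (\sum_i b i * v i)
  - c * (\sum_i b i * v i) ^+ 2.
Proof. by rewrite !sum_ord2 /=; ring. Qed.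

Variable u : torus_fun R 2.
(* Schwarz's theorem for [u]: without it the curvature tensor below would carry
   the antisymmetric part of the matrix of second derivatives. *)
Hypothesis hess_sym : forall i j x,
  partial i (partial j u) x = partial j (partial i u) x.

Local Notation g := (conformal_metric u).

Definition laplacian x : R := \sum_i partial i (partial i u) x.

Lemma partial_christoffel_conformal m k i j x :
  partial m (christoffel g k i j) x =
  (k == j)%:R * partial m (partial i u) x
  + (k == i)%:R * partial m (partial j u) x
  - (i == j)%:R * partial m (partial k u) x.
Proof.
have D l : is_derive x (delta_mx 0 m) (partial l u) (partial m (partial l u) x).
  exact/smooth_is_derive/smooth_partial/tfun_smooth.
rewrite {1}/partial (_ : christoffel g k i j =
    (fun y => (k == j)%:R * partial i u y)
    + (fun y => (k == i)%:R * partial j u y)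
    - (fun y => (i == j)%:R * partial k u y)); last first.
  by apply/funext => y; exact: christoffel_conformal.
have DZ (b : bool) l : is_derive x (delta_mx 0 m)
    (fun y => b%:R * partial l u y) (b%:R * partial m (partial l u) x).
  exact: is_deriveZ.
have := is_deriveB (is_deriveD (DZ (k == j) i) (DZ (k == i) j)) (DZ (i == j) k).
by case=> _; exact.
Qed.

Lemma riemann_conformal i j k l x :
  riemann g i j k l x =
  - laplacian x * ((i == k)%:R * (j == l)%:R - (i == l)%:R * (j == k)%:R).
Proof.
rewrite /riemann !partial_christoffel_conformal /laplacian.
under eq_bigr do rewrite !christoffel_conformal.
have S : partial 1 (partial 0 u) x = partial 0 (partial 1 u) x by [].
exact: (@riemann_algebra (fun p => partial p u x)
  (fun p q => partial p (partial q u) x)).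
Qed.

Lemma sec_conformal x v w : row_free (col_mx v w) ->
  sec g x v w = - expR (- (2 * u x)) * laplacian x.
Proof.
rewrite row_free_plane => vw.
have D0 : (v 0 0 * v 0 0 + v 0 1 * v 0 1) * (w 0 0 * w 0 0 + w 0 1 * w 0 1)
   - (v 0 0 * w 0 0 + v 0 1 * w 0 1) ^+ 2 != 0.
  rewrite (_ : _ - _ = (v 0 0 * w 0 1 - v 0 1 * w 0 0) ^+ 2).
    by rewrite sqrf_eq0.
  by ring.
have r0 : expR (2 * u x) != 0 by rewrite gt_eqF ?expR_gt0.
rewrite /sec gram_conformal !bilin_scalar.
rewrite !sum_ord2 !mxE !sum_ord2 !riemann_conformal /= expRN.
move: r0 D0 (laplacian x) => + + L.
move: (expR _) (v 0 0) (v 0 1) (w 0 0) (w 0 1) => r a b c d r0 D0.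
field; rewrite r0 /= (_ : _ - _ =
  r ^+ 2 * ((a * a + b * b) * (c * c + d * d) - (a * c + b * d) ^+ 2)).
  by rewrite mulf_neq0 ?expf_neq0.
by ring.
Qed.

Lemma ricci_conformal x : ricci g x = (- laplacian x)%:M.
Proof.
apply/matrixP => i j; rewrite !mxE sum_ord2 !riemann_conformal.
move: (laplacian x) => L.
by case: (ord2P i) => ->; case: (ord2P j) => ->;
  rewrite /= ?mulr1n ?mulr0n; ring.
Qed.

Lemma bakry_emery_conformal (f : torus_fun R 2) (N : R) x v :
  bilin (bakry_emery g f N x) v v =
  bilin (\matrix_(i, j) partial i (partial j f) x) v v
  + (\sum_i partial i u x * partial i f x - laplacian x) * (\sum_i v 0 i ^+ 2)
  - 2 * (\sum_i partial i u x * v 0 i) * (\sum_i partial i f x * v 0 i)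
  - (N - 2)^-1 * (\sum_i partial i f x * v 0 i) ^+ 2.
Proof.
have BE i j : bakry_emery g f N x i j =
    - laplacian x * (i == j)%:R
    + (partial i (partial j f) x - (partial i u x * partial j f x
        + partial j u x * partial i f x
        - (i == j)%:R * \sum_k partial k u x * partial k f x))
    - (N - 2)^-1 * (partial i f x * partial j f x).
  rewrite -hess_conformal mulr_natr /bakry_emery ricci_conformal.
  by set B := hess _ _ _; set C := df_otimes_df _ _; rewrite !mxE.
rewrite !bilin_sum.
under eq_bigr do under eq_bigr do rewrite BE.
under [X in _ = X + _ - _ - _]eq_bigr do under eq_bigr do rewrite mxE.
exact: (@bakry_emery_algebra (fun p => partial p u x) (fun p => partial p f x)
  (fun p q => partial p (partial q f) x) (fun p => v 0 p)).
Qed.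

End ConformalSurface.

(** * The logarithmic potential *)

Lemma cosD2piz {R : realType} (y : R) (z : int) :
  cos (2 * pi * (y + z%:~R)) = cos (2 * pi * y).
Proof.
have period (t : R) m : cos (t + 2 * pi * m%:R) = cos t.
  by rewrite mulr_natl mulr_natr; exact: (periodicn (@cosD2pi R)).
rewrite mulrDr; case: z => m; first exact: period.
rewrite NegzE -[in RHS](subrK (2 * pi * m.+1%:R) (2 * pi * y)) period.
by rewrite mulrNz mulrN.
Qed.

Section ScaledFunction.
Context {R : realType} {n : nat} (c : R) (F : torus_fun R n).

Lemma scaled_periodic : Defs.periodic (fun x => c * F x).
Proof. by move=> x z; rewrite tfun_periodic. Qed.

Definition scaled : torus_fun R n :=
  TorusFun scaled_periodic (smoothZ c (tfun_smooth F)).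

Lemma partial_scaled i x : partial i scaled x = c * partial i F x.
Proof. by apply: deriveZ; exact/smooth_derivable/tfun_smooth. Qed.

Lemma hess_scaled i j x :
  partial i (partial j scaled) x = c * partial i (partial j F) x.
Proof.
rewrite (_ : partial j scaled = c \*: partial j F).
  by apply: deriveZ; exact/smooth_derivable/smooth_partial/tfun_smooth.
by apply/funext => y; exact: partial_scaled.
Qed.

End ScaledFunction.

Section LogWell.
Context {R : realType} {n : nat} {eta : R}.
Hypothesis eta_gt0 : 0 < eta.
Implicit Types (x : 'rV[R]_n) (i j : 'I_n).

(** Positive, and equal to [eta] exactly on the lattice; near the origin it is
    [eta + 2 pi^2 |x|^2] up to higher order. *)
Definition well x : R := eta + \sum_i (1 - cos (2 * pi * x 0 i)).

Lemma well_ge x i : 1 - cos (2 * pi * x 0 i) <= well x.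
Proof.
rewrite /well (bigD1 i) //= addrCA lerDl.
by rewrite addr_ge0 ?(ltW eta_gt0) ?sumr_ge0.
Qed.

Lemma well_le x : well x <= eta + n%:R * 2.
Proof.
have -> : n%:R * 2 = \sum_(i < n) (2 : R).
  by rewrite sumr_const card_ord mulr_natl.
rewrite lerD2l ler_sum // => i _.
by have := cos_geN1 (2 * pi * x 0 i); lra.
Qed.

Lemma well_gt0 x : 0 < well x.
Proof. by rewrite ltr_pwDl ?sumr_ge0. Qed.

Lemma well0 : well 0 = eta.
Proof.
rewrite /well big1 ?addr0 // => i _.
by rewrite mxE mulr0 cos0 subrr.
Qed.

Lemma well_periodic x (z : 'rV[int]_n) : well (x + map_mx intr z) = well x.
Proof.
by congr (_ + _); apply: eq_bigr => i _; rewrite !mxE cosD2piz.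
Qed.

Lemma well_smooth : smooth well.
Proof.
apply: (smoothD (smooth_cst eta)); apply: smooth_sum => i.
rewrite (_ : (fun x => _) = (fun=> 1) \+ (fun x => -1 * cos (2 * pi * x 0 i))).
  exact/(smoothD (smooth_cst 1))/smoothZ/smooth_cos/smoothZ/smooth_coord.
by apply/funext => x; rewrite /= mulN1r.
Qed.

Lemma is_derive_angle i j x :
  is_derive x (delta_mx 0 j) (fun y : 'rV[R]_n => 2 * pi * y 0 i)
    (2 * pi * (i == j)%:R).
Proof.
have := is_deriveZ (2 * pi) (is_derive_coord i x (delta_mx 0 j)).
by rewrite mxE eqxx.
Qed.

Lemma partial_well i x : partial i well x = 2 * pi * sin (2 * pi * x 0 i).
Proof.
have D j : is_derive x (delta_mx 0 i) (fun y => 1 - cos (2 * pi * y 0 j))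
    (sin (2 * pi * x 0 j) * (2 * pi * (j == i)%:R)).
  have := is_deriveB (is_derive_cst (1 : R) x (delta_mx 0 i))
    (is_derive_comp1 (is_derive_cos _) (is_derive_angle j i x)).
  by rewrite sub0r mulNr opprK.
have [_ ] := is_deriveD (is_derive_cst eta x (delta_mx 0 i)) (is_derive_sum D).
rewrite add0r /partial (_ : cst eta + _ = well) => [->|]; last first.
  by apply/funext => y; rewrite /well fctE fct_sumE.
rewrite (bigD1 i) //= big1 => [|j /negPf->]; last by rewrite !mulr0.
by rewrite eqxx addr0 mulr1 mulrC.
Qed.

(** A smooth periodic substitute for [- r^2 ln (r^2)]. *)
Definition log_well x : R := - (well x * ln (well x)).

Lemma log_well_periodic : Defs.periodic log_well.
Proof. by move=> x z; rewrite /log_well well_periodic. Qed.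

Lemma log_well_smooth : smooth log_well.
Proof.
rewrite (_ : log_well = fun x => -1 * (well x * ln (well x))).
  apply/smoothZ/smoothM; first exact: well_smooth.
  exact/smooth_ln/well_smooth/well_gt0.
by apply/funext => x; rewrite mulN1r.
Qed.

Definition log_potential : torus_fun R n :=
  TorusFun log_well_periodic log_well_smooth.

Lemma partial_log_potential i x :
  partial i log_potential x =
  - (2 * pi * sin (2 * pi * x 0 i) * (ln (well x) + 1)).
Proof.
have Ds := smooth_is_derive i x well_smooth.
have Dl := is_derive_comp1 (is_derive1_ln (well_gt0 x)) Ds.
have [_] := is_deriveN (is_deriveM Ds Dl).
rewrite partial_well => H; rewrite [LHS]H /= /GRing.scale /=.
by have s0 := gt_eqF (well_gt0 x); field; rewrite s0.
Qed.

Lemma hess_log_potential i j x :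
  partial j (partial i log_potential) x =
  - ((2 * pi) ^+ 2 * ((i == j)%:R * cos (2 * pi * x 0 i) * (ln (well x) + 1)
     + sin (2 * pi * x 0 i) * sin (2 * pi * x 0 j) / well x)).
Proof.
have Ds := smooth_is_derive j x well_smooth.
have Dl := is_derive_comp1 (is_derive1_ln (well_gt0 x)) Ds.
have Dsin := is_deriveZ (2 * pi)
  (is_derive_comp1 (is_derive_sin _) (is_derive_angle i j x)).
have [_] := is_deriveN (is_deriveM Dsin
  (is_deriveD Dl (is_derive_cst (1 : R) x (delta_mx 0 j)))).
rewrite (_ : partial i log_potential = fun y =>
  - (2 * pi * sin (2 * pi * y 0 i) * (ln (well y) + 1))); last first.
  by apply/funext => y; exact: partial_log_potential.
rewrite partial_well => H; rewrite [LHS]H.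
rewrite (_ : (@ln R \o well + cst 1) x = ln (well x) + 1) // /= /GRing.scale /=.
move: (well x) (cos _) (sin _) (sin _) ((i == j)%:R) (well_gt0 x)
  => s c a b d /gt_eqF s0.
by field; rewrite s0.
Qed.

End LogWell.

(** * Bounds on the potential uniform in the depth of the well *)

Section LogBounds.
Context {R : realType}.

(** The point is that [s] may be close to [0].  With [t = - ln s >= 0] the
    inequality [t^2 <= 4 e^t] follows from [1 + t / 2 <= e^(t / 2)]. *)
Lemma sqr_ln_bound {s : R} : 0 < s -> s <= 5 -> s * ln s ^+ 2 <= 80.
Proof.
move=> s0 s5; have [ln0|/ltW ln0] := leP (ln s) 0; last first.
  have ln4 : ln s <= 4.
    by have := @le_ln1Dx R (s - 1); rewrite (_ : 1 + (s - 1) = s); [lra|ring].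
  nra.
have h : expR (- ln s / 2) ^+ 2 = s^-1.
  by rewrite -expRM_natl mulrC divfK ?pnatr_eq0 // expRN lnK.
have k : (1 - ln s / 2) ^+ 2 <= s^-1.
  have e1 : 1 - ln s / 2 <= expR (- ln s / 2).
    by have := expR_ge1Dx (- ln s / 2); lra.
  have l1 : 0 <= 1 - ln s / 2 by lra.
  by rewrite -h !expr2 ler_pM.
have : s * (1 - ln s / 2) ^+ 2 <= 1 by rewrite -ler_pdivlMl ?mulr1.
nra.
Qed.

Lemma ln_bound {s : R} : 0 < s -> s <= 5 -> `|s * ln s| <= 20.
Proof.
move=> s0 s5; have := sqr_ln_bound s0 s5.
by rewrite ler_norml => h; apply/andP; split; nra.
Qed.

Context {eta : R}.
Hypotheses (eta_gt0 : 0 < eta) (eta_le1 : eta <= 1).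
Implicit Types (x : 'rV[R]_2) (i j : 'I_2).

Local Notation s := (@well R 2 eta).
Local Notation F := (@log_potential R 2 eta eta_gt0).

Lemma well_le5 x : s x <= 5.
Proof. by apply: le_trans (well_le _) _; have := eta_le1; lra. Qed.

(** [s] dominates the square of its gradient, as a nonnegative function does. *)
Lemma sqr_sin_le_well x i : sin (2 * pi * x 0 i) ^+ 2 <= 2 * s x.
Proof.
have := well_ge eta_gt0 x i; rewrite sin2cos2.
have := cos_le1 (2 * pi * x 0 i); have := cos_geN1 (2 * pi * x 0 i); nra.
Qed.

Lemma log_potential_bound x : `|F x| <= 20.
Proof. by rewrite /= normrN ln_bound ?well_gt0 ?well_le5. Qed.

(** The derivative is [- (d_i s) (ln s + 1)]; its square is at most a constant
    times [s (ln s + 1)^2], and that is bounded uniformly in [eta]. *)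
Lemma partial_log_potential_bound i x : `|partial i F x| <= 2 * pi * 19.
Proof.
have pi0 := pi_ge0 R.
rewrite partial_log_potential normrN -mulrA normrM.
rewrite (ger0_norm (x := 2 * pi)); last lra.
apply: ler_wpM2l; first lra.
have := sqr_sin_le_well x i; have := well_gt0 eta_gt0 x; have := well_le5 x.
move=> s5 s0; have := sqr_ln_bound s0 s5.
move: (s x) (ln _) (sin _) s0 s5 => t y a t0 t5 ty at2.
have : (a * (y + 1)) ^+ 2 <= 19 ^+ 2.
  rewrite exprMn (le_trans (ler_wpM2r (sqr_ge0 _) at2)) //.
  have := mulr_ge0 (ltW t0) (sqr_ge0 (y - 1)); lra.
by move: (a * (y + 1)) => b b2; rewrite ler_norml; apply/andP; split; nra.
Qed.

(** The unbounded part of the Hessian is [- (ln s) d_i d_j s], where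
    [d_i d_i s] is [(2 pi)^2 cos (2 pi x_i)]; replacing this cosine by [1]
    costs [(1 - cos (2 pi x_i)) |ln s| <= s |ln s|], which is bounded. *)
Lemma hess_log_potential_bound i j x :
  `|partial j (partial i F) x - (i == j)%:R * ((2 * pi) ^+ 2 * - ln (s x))|
  <= (2 * pi) ^+ 2 * 23.
Proof.
rewrite hess_log_potential.
have := well_gt0 eta_gt0 x; have := well_le5 x.
have := well_ge eta_gt0 x i; have := sqr_sin_le_well x i.
have := sqr_sin_le_well x j.
have := cos_le1 (2 * pi * x 0 i); have := cos_geN1 (2 * pi * x 0 i).
move: (sin (_ * x 0 i)) (sin (_ * x 0 j)) (cos _) => a b c.
move: (s x) => t cN1 c1 bt at' ct t5 t0.
have tl := ln_bound t0 t5.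
have ab : `|a * b / t| <= 2.
  rewrite normrM normfV (gtr0_norm t0) ler_pdivrMr // ler_norml.
  by apply/andP; split; nra.
have -> : - ((2 * pi) ^+ 2 * ((i == j)%:R * c * (ln t + 1) + a * b / t)) -
    (i == j)%:R * ((2 * pi) ^+ 2 * - ln t) =
    (2 * pi) ^+ 2 * ((i == j)%:R * ((1 - c) * ln t - c) - a * b / t) by ring.
rewrite normrM ger0_norm ?sqr_ge0 //; apply: ler_wpM2l; first exact: sqr_ge0.
move: ab; move: (a * b / t) => r.
have cl : `|(1 - c) * ln t| <= 20.
  apply: le_trans tl; rewrite !normrM ler_wpM2r //.
  by rewrite !ger0_norm; lra.
move: cl; move: ((1 - c) * ln t) => q.
rewrite !ler_norml => /andP[q1 q2] /andP[r1 r2].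
by case: (i == j); rewrite ?mul1r ?mul0r; apply/andP; split; lra.
Qed.

End LogBounds.

(** * Lengths of segments and the diameter *)

Section Diameter.
Context {R : realType} {n : nat} (g : torus_metric R n).
Implicit Types (p q v : 'rV[R]_n).

Lemma is_derive_segment p v (t : R) :
  is_derive t (1 : R) (fun s : R => p + s *: v) v.
Proof.
have /diff_derivable H : differentiable (fun s : R => s *: v) t by [].
have E : 'D_1 (fun s : R => s *: v) t = v.
  by rewrite deriveE // diff_val scale1r.
have D : is_derive t (1 : R) (fun s : R => s *: v) v.
  by apply: DeriveDef => //; exact: H.
have := is_deriveD (is_derive_cst p t 1) D.
by rewrite add0r.
Qed.

Lemma segment_C1 p v : C1_curve (fun t : R => p + t *: v).
Proof.
split=> [t|]; first by have [] := is_derive_segment p v t.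
rewrite (_ : derive1 _ = cst v); first exact: cst_continuous.
by apply/funext => t; rewrite derive1E; have [] := is_derive_segment p v t.
Qed.

Lemma segment_length_le p v (K : R) : 0 <= K ->
  (forall x, bilin (g x) v v <= K ^+ 2) ->
  (arc_length g (fun t : R => p + t *: v)%R 0 1 <= K%:E)%E.
Proof.
move=> K0 gK; rewrite /arc_length.
have -> : derive1 (fun t : R => p + t *: v) = cst v.
  by apply/funext => t; rewrite derive1E; have [] := is_derive_segment p v t.
have cspeed : continuous (fun x => bilin (g x) v v).
  rewrite (_ : (fun x => _) = fun x => \sum_i \sum_j v 0 i * g x i j * v 0 j).
    apply: (@Ck_continuous _ _ 0).
    apply: smooth_sum => i; apply: smooth_sum => j.
    exact/(smoothM _ (smooth_cst _))/smoothZ/gram_smooth.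
  by apply/funext => x; exact: bilin_sum.
have mlen : measurable_fun setT
    (fun t : R => Num.sqrt (bilin (g (p + t *: v)) v v)).
  apply: continuous_measurable_fun => t.
  apply: (@continuous_comp _ _ _ (fun t : R => bilin (g (p + t *: v)) v v)
    Num.sqrt); last exact: sqrt_continuous.
  apply: (@continuous_comp _ _ _ (fun t : R => p + t *: v)
    (fun x => bilin (g x) v v)); last exact: cspeed.
  have [dt _] := is_derive_segment p v t.
  exact/differentiable_continuous/derivable1_diffP.
apply: (@le_trans _ _
  (\int[lebesgue_measure]_(t in `[0%R, 1%R]) (cst K%:E t))%E).
  apply: ge0_le_integral => //=.
  - by apply/measurable_EFinP; apply: measurable_funTS.
  - move=> t _; rewrite lee_fin -[K in (_ <= K)%R](ger0_norm K0).
    by rewrite -sqrtr_sqr ler_wsqrtr.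
rewrite integral_cst //= lebesgue_measure_itv /= lte_fin ltr01 oppr0 adde0.
by rewrite mule1.
Qed.

(** Any two points of the torus have lifts that differ by a vector of the unit
    cube, so that a segment along such a vector joins them. *)
Lemma diam_le (K : R) : 0 <= K ->
  (forall x v, (forall i, 0 <= v 0 i <= 1) -> bilin (g x) v v <= K ^+ 2) ->
  (diam g <= K%:E)%E.
Proof.
move=> K0 gK; apply: ge_ereal_sup => _ [p [q ->]].
pose z : 'rV[int]_n := \row_i - Num.floor (q 0 i - p 0 i).
pose v := q + map_mx intr z - p.
apply: le_trans (segment_length_le p v K K0 _) => [|x]; last first.
  apply: gK => i; rewrite /v !mxE.
  have := floor_le (q 0 i - p 0 i).
  have := floorD1_gt (q 0 i - p 0 i).
  rewrite intrD mulrNz; lra.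
apply: ereal_inf_lbound; exists z.
have := path_arc g ler01 (segment_C1 p v).
by rewrite scale0r addr0 scale1r /v addrC subrK.
Qed.

End Diameter.

(** * Small multiples of a potential with nearly isotropic Hessian *)

Lemma expR_small {R : realType} (t : R) :
  `|t| <= 2^-1 -> 2^-1 <= expR t /\ expR t <= 2.
Proof.
rewrite ler_norml => /andP[t1 t2].
have e1 := expR_ge1Dx t; have e2 := expR_ge1Dx (- t).
split; first by lra.
have e3 : 2^-1 <= expR (- t) by lra.
have := expR_gt0 t; have := expRxMexpNx_1 t; nra.
Qed.

Lemma laplacian_scaled {R : realType} (c : R) (F : torus_fun R 2) x :
  laplacian (scaled c F) x = c * laplacian F x.
Proof.
by rewrite /laplacian mulr_sumr; apply: eq_bigr => i _; exact: hess_scaled.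
Qed.

(** The key cancellation: writing [H = l I + E], the multiple of the identity
    contributes [2 c l |v|^2] through the Hessian of [f = 2 c F] and
    [- 2 c l |v|^2] through the Laplacian of [u = c F], so the bound does not
    depend on [l].  Here [a] is [dF], [H] is the Hessian of [F], [m] is
    [1 / (N - 2)], and [e] is the conformal factor, through which the flat norm
    of [v] is compared with its norm in the rescaled metric. *)
Lemma bakry_emery_lower_bound {R : realType} {v a : 'I_2 -> R}
    {H : 'I_2 -> 'I_2 -> R} {l C c m e : R} :
  0 <= c -> 0 <= m -> 2^-1 <= e ->
  (forall i, `|a i| <= C) ->
  (forall i j, `|H i j - (i == j)%:R * l| <= C) ->
  - (2 * (6 * (c * C) + 8 * (c * C) ^+ 2 + 8 * (c * C) ^+ 2 * m))
    * (e * (v 0 * v 0 + v 1 * v 1)) <=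
  v 0 * (2 * c * H 0 0) * v 0 + v 0 * (2 * c * H 0 1) * v 1
  + (v 1 * (2 * c * H 1 0) * v 0 + v 1 * (2 * c * H 1 1) * v 1)
  + (c * a 0 * (2 * c * a 0) + c * a 1 * (2 * c * a 1)
     - c * (H 0 0 + H 1 1)) * (v 0 ^+ 2 + v 1 ^+ 2)
  - 2 * (c * a 0 * v 0 + c * a 1 * v 1)
    * (2 * c * a 0 * v 0 + 2 * c * a 1 * v 1)
  - m * (2 * c * a 0 * v 0 + 2 * c * a 1 * v 1) ^+ 2.
Proof.
move=> c0 m0 e1 aC HC.
have := HC 0 0; have := HC 0 1; have := HC 1 0; have := HC 1 1.
have := aC 0; have := aC 1; rewrite /= !mul1r !mul0r !subr0.
move: (a 0) (a 1) (H 0 0) (H 0 1) (H 1 0) (H 1 1) (v 0) (v 1).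
move=> a0 a1 h00 h01 h10 h11 x y a1C a0C E11 E10 E01 E00.
have C0 : 0 <= C by exact: le_trans (normr_ge0 _) a0C.
have prod_ge (h s t : R) :
    `|h| <= C -> - C * (s ^+ 2 + t ^+ 2) <= 2 * (s * h * t).
  rewrite ler_norml => /andP[h1 h2].
  have Cph : 0 <= C + h by lra.
  have Cmh : 0 <= C - h by lra.
  have := mulr_ge0 Cph (sqr_ge0 (s + t)).
  have := mulr_ge0 Cmh (sqr_ge0 (s - t)).
  by lra.
have sqr_le (b : R) : `|b| <= C -> b ^+ 2 <= C ^+ 2.
  by rewrite ler_norml => /andP[? ?]; nra.
set V := x ^+ 2 + y ^+ 2; have V0 : 0 <= V by rewrite addr_ge0 ?sqr_ge0.
set p := a0 * x + a1 * y.
(* Cauchy-Schwarz, through Lagrange's identity. *)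
have p2 : p ^+ 2 <= 2 * C ^+ 2 * V.
  apply: (@le_trans _ _ ((a0 ^+ 2 + a1 ^+ 2) * V)).
    by have := sqr_ge0 (a0 * y - a1 * x); rewrite /p /V; lra.
  by rewrite ler_wpM2r //; have := sqr_le _ a0C; have := sqr_le _ a1C; lra.
(* The part of first order in [c]: all that remains once [l] has dropped out. *)
have Q : - 6 * C * V <= 2 * (x * (h00 - l) * x + x * h01 * y + y * h10 * x
    + y * (h11 - l) * y) - (h00 - l + (h11 - l)) * V.
  have := prod_ge _ x x E00; have := prod_ge _ x y E01.
  have := prod_ge _ y x E10; have := prod_ge _ y y E11.
  have : (h00 - l + (h11 - l)) * V <= 2 * C * V.
    rewrite ler_wpM2r //; move: E00 E11; rewrite !ler_norml.
    by move=> /andP[_ ?] /andP[_ ?]; lra.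
  by rewrite /V; lra.
have Qc := ler_wpM2l c0 Q.
have Pc : c ^+ 2 * (1 + m) * p ^+ 2 <= c ^+ 2 * (1 + m) * (2 * C ^+ 2 * V).
  by rewrite ler_wpM2l // mulr_ge0 ?sqr_ge0 ?addr_ge0.
have A0 : 0 <= 2 * c ^+ 2 * (a0 ^+ 2 + a1 ^+ 2) * V.
  by rewrite !mulr_ge0 ?addr_ge0 ?sqr_ge0.
have D0 : 0 <= 6 * (c * C) + 8 * (c * C) ^+ 2 + 8 * (c * C) ^+ 2 * m.
  by rewrite !addr_ge0 ?mulr_ge0 ?sqr_ge0.
have eV : V <= 2 * (e * V) by rewrite mulrA ler_peMl //; lra.
have De := ler_wpM2l D0 eV.
move: Qc Pc A0 De; rewrite /p /V; lra.
Qed.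

Section SmallPotential.
Context {R : realType} {F : torus_fun R 2} {Lam : 'rV[R]_2 -> R} {C c : R}.
Implicit Types (x v w : 'rV[R]_2) (i j : 'I_2).

Hypothesis F_bound : forall x, `|F x| <= C.
Hypothesis dF_bound : forall i x, `|partial i F x| <= C.
Hypothesis hessF_bound : forall i j x,
  `|partial i (partial j F) x - (i == j)%:R * Lam x| <= C.
Hypothesis Lam_ge : forall x, - C <= Lam x.
Hypothesis hessF_sym : forall i j x,
  partial i (partial j F) x = partial j (partial i F) x.
Hypotheses (c_ge0 : 0 <= c) (cC_le : c * C <= 16^-1).

Local Notation u := (scaled c F).
Local Notation f := (scaled (2 * c) F).
Local Notation g := (conformal_metric u).

Lemma hess_scaled_sym i j x :
  partial i (partial j u) x = partial j (partial i u) x.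
Proof. by rewrite hess_scaled [RHS]hess_scaled hessF_sym. Qed.

Lemma C_ge0 : 0 <= C.
Proof. exact: le_trans (normr_ge0 _) (F_bound 0). Qed.

Lemma conformal_exponent_small x : `|2 * u x| <= 2^-1.
Proof.
rewrite /= !normrM (ger0_norm (x := 2)) // (ger0_norm c_ge0).
have := ler_wpM2l c_ge0 (F_bound x); have := cC_le; lra.
Qed.

Lemma conformal_factor_bounds x : 2^-1 <= expR (2 * u x) /\ expR (2 * u x) <= 2.
Proof. exact/expR_small/conformal_exponent_small. Qed.

Lemma conformal_factorV_bounds x :
  2^-1 <= expR (- (2 * u x)) /\ expR (- (2 * u x)) <= 2.
Proof.
by apply: expR_small; rewrite normrN; exact: conformal_exponent_small.
Qed.

Lemma laplacian_ge x : 2 * Lam x - 2 * C <= laplacian F x.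
Proof.
have h i : Lam x - C <= partial i (partial i F) x.
  have := hessF_bound i i x; rewrite eqxx mul1r ler_norml => /andP[+ _]; lra.
rewrite /laplacian sum_ord2.
by rewrite (_ : _ - _ = (Lam x - C) + (Lam x - C)) ?lerD//; ring.
Qed.

Lemma sec_small x v w : row_free (col_mx v w) ->
  sec g x v w = - expR (- (2 * u x)) * (c * laplacian F x).
Proof.
by move=> vw; rewrite (sec_conformal _ hess_scaled_sym) // laplacian_scaled.
Qed.

(** Where [Lam] is large the surface is negatively curved, so that the positive
    part of the curvature comes from the error term and from [Lam >= - C]. *)
Lemma sec_le_small : sec_le g (8 * (c * C)).
Proof.
move=> x v w vw; rewrite sec_small //.
have := ler_wpM2l c_ge0 (laplacian_ge x).
have := ler_wpM2l c_ge0 (Lam_ge x); have := mulr_ge0 c_ge0 C_ge0.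
have [_ e2] := conformal_factorV_bounds x; have e0 := expR_gt0 (- (2 * u x)).
rewrite mulrBr mulrN [c * (2 * Lam x)]mulrCA [c * (2 * C)]mulrCA.
move: (expR _) (c * laplacian _ _) (c * Lam x) (c * C) e0 e2 => e l a d.
nra.
Qed.

(** The constant [8] covers both signs of [Lam x - C]: when it is positive the
    factor [e^(-2u)] is bounded below by [1 / 2], otherwise it is bounded above
    by [2]. *)
Lemma min_sec_le_small x : (min_sec g <= (8 * (c * C) - c * Lam x)%:E)%E.
Proof.
have e01 : row_free (col_mx (delta_mx 0 0 : 'rV[R]_2)
                            (delta_mx 0 1 : 'rV[R]_2)).
  by rewrite row_free_plane !mxE /= mulr0 subr0 mulr1 oner_neq0.
apply: (@le_trans _ _ (sec g x (delta_mx 0 0) (delta_mx 0 1))%:E).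
  by apply: ereal_inf_lbound; exists x, (delta_mx 0 0), (delta_mx 0 1).
rewrite lee_fin sec_small //.
have := ler_wpM2l c_ge0 (laplacian_ge x).
have := ler_wpM2l c_ge0 (Lam_ge x); have := mulr_ge0 c_ge0 C_ge0.
have [e1 e2] := conformal_factorV_bounds x.
rewrite mulrBr mulrN [c * (2 * Lam x)]mulrCA [c * (2 * C)]mulrCA.
move: (expR _) (c * laplacian _ _) (c * Lam x) (c * C) e1 e2 => e l a d e1 e2.
by have [] := leP a d; nra.
Qed.

Lemma bakry_emery_ge_small (N : R) : 2 < N ->
  bakry_emery_ge g f N
    (- (2 * (6 * (c * C) + 8 * (c * C) ^+ 2 + 8 * (c * C) ^+ 2 / (N - 2)))).
Proof.
move=> N2 x v; rewrite (bakry_emery_conformal _ hess_scaled_sym).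
rewrite gram_conformal bilin_scalar bilin_sum laplacian_scaled /laplacian.
rewrite !sum_ord2 !mxE.
have HE p q := hess_scaled (2 * c) F p q x.
have PE := partial_scaled c F ^~ x; have P2E := partial_scaled (2 * c) F ^~ x.
rewrite !HE !PE !P2E.
have [e1 _] := conformal_factor_bounds x.
apply: (bakry_emery_lower_bound (v := fun i => v 0 i)
  (a := fun p => partial p F x) (H := fun p q => partial p (partial q F) x)
  c_ge0 _ e1 _ _) => //.
by rewrite invr_ge0 subr_ge0 ltW.
Qed.

Lemma diam_small : (diam g <= 10%:E)%E.
Proof.
apply: diam_le => // x v v01; rewrite gram_conformal bilin_scalar sum_ord2.
have := v01 0; have := v01 1 => /andP[? ?] /andP[? ?].
have [_ e2] := conformal_factor_bounds x; have e0 := expR_gt0 (2 * u x).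
have : v 0 0 * v 0 0 + v 0 1 * v 0 1 <= 2 by nra.
have : 0 <= v 0 0 * v 0 0 + v 0 1 * v 0 1 by nra.
move: (_ + _) => s s0 s2; move: (expR _) e0 e2 => e e0 e2; nra.
Qed.

End SmallPotential.

(** * The sequence *)

Section Sequence.
Context {R : realType}.
Implicit Types (i : nat) (x : 'rV[R]_2).

(* [- ln eta] grows faster than [1 / c], which is what drives the curvature at
   the origin to minus infinity. *)
Let eta i : R := expR (- i.+1%:R ^+ 2).

Let eta_gt0 i : 0 < eta i. Proof. exact: expR_gt0. Qed.

Let eta_le1 i : eta i <= 1.
Proof. by rewrite expR_le1 oppr_le0 sqr_ge0. Qed.

Let F i : torus_fun R 2 := log_potential (eta_gt0 i).

Let Lam i x : R := (2 * pi) ^+ 2 * - ln (well (eta := eta i) x).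

(* A common bound for [20], [2 pi * 19] and [(2 pi)^2 * 23]. *)
Let C : R := (2 * pi) ^+ 2 * 23.

Let delta i : R := 16^-1 * harmonic i.

Let c i : R := delta i / C.

Let twopi_ge4 : 4 <= 2 * pi :> R.
Proof. by have := pi_ge2 R; lra. Qed.

Let C_gt0 : 0 < C.
Proof. by rewrite mulr_gt0 ?exprn_gt0 //; have := twopi_ge4; lra. Qed.

Let c_ge0 i : 0 <= c i.
Proof. by rewrite divr_ge0 ?(ltW C_gt0) // mulr_ge0 ?invr_ge0. Qed.

Let cC i : c i * C = delta i.
Proof. by rewrite /c divfK // gt_eqF. Qed.

Let cC_le i : c i * C <= 16^-1.
Proof.
by rewrite cC ler_piMr ?invr_ge0 // invf_le1 ?ler1n.
Qed.

Let F_bound i x : `|F i x| <= C.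
Proof.
apply: le_trans (log_potential_bound (eta_gt0 i) (eta_le1 i) x) _.
by rewrite /C; have := twopi_ge4; nra.
Qed.

Let dF_bound i k x : `|partial k (F i) x| <= C.
Proof.
apply: le_trans (partial_log_potential_bound (eta_gt0 i) (eta_le1 i) k x) _.
by rewrite /C; have := twopi_ge4; nra.
Qed.

Let hessF_bound i k l x :
  `|partial k (partial l (F i)) x - (k == l)%:R * Lam i x| <= C.
Proof.
by rewrite eq_sym; exact: (hess_log_potential_bound (eta_gt0 i) (eta_le1 i)).
Qed.

Let Lam_ge i x : - C <= Lam i x.
Proof.
rewrite /C /Lam -mulrN ler_wpM2l ?sqr_ge0 // lerN2.
have w0 := well_gt0 (eta_gt0 i) x; have w5 := well_le5 (eta_le1 i) x.
by have := ln_sublinear w0; lra.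
Qed.

Let hessF_sym i k l x :
  partial k (partial l (F i)) x = partial l (partial k (F i)) x.
Proof.
rewrite !hess_log_potential eq_sym.
by have [->|_] := eqVneq k l; rewrite // !mul0r !add0r [sin _ * _]mulrC.
Qed.

(* [368 = 16 * 23], the factors in [delta] and [C]. *)
Let Lam0 i : c i * Lam i 0 = i.+1%:R / 368.
Proof.
rewrite /c /delta /C /Lam well0 expRK opprK.
have := twopi_ge4; move: (2 * pi) => P P4.
have P0 : P != 0 by rewrite gt_eqF //; lra.
have := ltr0Sn R i; rewrite /harmonic /=; move: (i.+1%:R) => k k0.
by field; rewrite P0 gt_eqF.
Qed.

Definition well_metric i : torus_metric R 2 :=
  conformal_metric (scaled (c i) (F i)).

Definition well_weight i : torus_fun R 2 := scaled (2 * c i) (F i).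

Definition well_error i (N : R) : R :=
  2 * (6 * delta i + 8 * delta i ^+ 2 + 8 * delta i ^+ 2 / (N - 2)).

Lemma well_sec_le i : (0 < i)%N -> sec_le (well_metric i) i%:R^-1.
Proof.
move=> i0 x v w vw.
apply: le_trans (sec_le_small (F_bound i) (hessF_bound i) (Lam_ge i)
  (hessF_sym i) (c_ge0 i) (cC_le i) _ _ _ vw) _.
rewrite cC /delta.
have : harmonic i <= i%:R^-1 :> R.
  by rewrite lef_pV2 ?posrE ?ltr0n // ler_nat.
have : 0 <= harmonic i :> R by rewrite invr_ge0.
lra.
Qed.

Lemma well_bakry_emery_ge i (N : R) : 2 < N ->
  bakry_emery_ge (well_metric i) (well_weight i) N (- well_error i N).
Proof.
move=> N2; rewrite /well_error -cC.
exact: (bakry_emery_ge_small (F_bound i) (dF_bound i) (hessF_bound i)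
  (hessF_sym i) (c_ge0 i) (cC_le i)).
Qed.

Lemma well_diam_le i : (diam (well_metric i) <= 10%:E)%E.
Proof. exact: (diam_small (F_bound i) (c_ge0 i) (cC_le i)). Qed.

Lemma well_error_cvg0 (N : R) : well_error i N @[i --> \oo] --> (0 : R).
Proof.
have d0 : delta i @[i --> \oo] --> (0 : R).
  by rewrite -(mulr0 16^-1); apply: cvgM; [exact: cvg_cst|exact: cvg_harmonic].
have d2 : delta i ^+ 2 @[i --> \oo] --> (0 : R).
  by rewrite -[X in _ --> X](mulr0 0); exact: cvgM.
rewrite -[X in _ --> X](_ : 2 * (6 * 0 + 8 * 0 + 8 * 0 / (N - 2)) = 0);
  last by ring.
apply: cvgM; first exact: cvg_cst.
apply: cvgD; first (apply: cvgD; apply: cvgM => //; exact: cvg_cst).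
by apply: cvgM; [apply: cvgM => //|]; exact: cvg_cst.
Qed.

Lemma well_min_sec_cvg : min_sec (well_metric i) @[i --> \oo] --> -oo%E.
Proof.
apply/cvgeNyPle => A; near=> i.
apply: le_trans (min_sec_le_small (F_bound i) (hessF_bound i) (Lam_ge i)
  (hessF_sym i) (c_ge0 i) (cC_le i) 0) _.
rewrite lee_fin Lam0.
have : (1 - A) * 368 <= i%:R by near: i; exact: nbhs_infty_ger.
have := cC_le i; rewrite -(natr1 i); lra.
Unshelve. all: by end_near. Qed.

End Sequence.

Theorem lemma8p1 (R : realType) :
  exists (g : nat -> torus_metric R 2) (f : nat -> torus_fun R 2),
    (exists eps : nat -> R -> R,
      forall N : R, 2 < N ->
        (forall i : nat, (0 < i)%N ->
          [/\ sec_le (g i) (i%:R^-1),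
              bakry_emery_ge (g i) (f i) N (- eps i N)
            & (diam (g i) <= 10%:E)%E]) /\
        eps i N @[i --> \oo] --> (0 : R)) /\
    min_sec (g i) @[i --> \oo] --> -oo%E.
Proof.
exists well_metric, well_weight; split; last exact: well_min_sec_cvg.
exists well_error => N N2; split; last exact: well_error_cvg0.
move=> i i0; split.
- exact: well_sec_le.
- exact: well_bakry_emery_ge.
- exact: well_diam_le.
Qed.
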